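(* Let $A,B\in\mathbb{R}_{\max}^{m\times n}$ have no rows identically equal to $-\infty$ and no common column identically equal to $-\infty$, let $s(\lambda)$ be the spectral function of $(A,B)$, and denote $\kappa:=\min(2m,n)$. 1. There exist integers $k_1,l_1,k_2,l_2$ such that $1\le l_1\le\kappa$, $k_1=l_1-2t_1$ with an integer $0\le t_1\le\lfloor l_1/2\rfloor$, $1\le l_2\le\kappa$, $k_2=l_2-2t_2$ with an integer $0\le t_2\le\lfloor l_2/2\rfloor$, and $\alpha_1,\alpha_2\in\mathbb{R}$ such that $$s(\lambda)=\lambda k_1/l_1+\alpha_1\quad\text{if }\lambda\le-2\kappa^2\Delta(A,B),$$ $$s(\lambda)=-\lambda k_2/l_2+\alpha_2\quad\text{if }\lambda\ge2\kappa^2\Delta(A,B).$$ 2. Suppose that $A$ and $B$ have no columns identically equal to $-\infty$. Then there exist $\alpha_1\le r(A^{\sharp}B)$ and $\alpha_2\le r(B^{\sharp}A)$ such that $$s(\lambda)=\lambda+\alpha_1\quad\text{if }\lambda\le-2\kappa\Delta(A,B),$$ $$s(\lambda)=-\lambda+\alpha_2\quad\text{if }\lambda\ge2\kappa\Delta(A,B).$$ 3. Suppose that all entries of $A$ and $B$ are real. Then $$s(\lambda)=\lambda+r(A^{\sharp}B)\quad\text{if }\lambda\le\underline{C}(A,B),$$ $$s(\lambda)=-\lambda+r(B^{\sharp}A)\quad\text{if }\lambda\ge\overline{C}(A,B).$$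
   Context: $\mathbb{R}_{\max}=\mathbb{R}\cup\{-\infty\}$. For $A=(a_{ij})\in\mathbb{R}_{\max}^{m\times n}$ and $x\in\mathbb{R}_{\max}^n$, $(Ax)_i=\max_j(a_{ij}+x_j)$. For $y\in\mathbb{R}_{\max}^m$, $(A^{\sharp}y)_j=\min_{1\le i\le m}(-a_{ij}+y_i)$ with $(-\infty)+(+\infty)=+\infty$. $A^{\sharp}B$ denotes the composition $x\mapsto A^{\sharp}(Bx)$; $\wedge$ is componentwise minimum. For an order-preserving, additively homogeneous map $f$ of $\mathbb{R}_{\max}^n$ to itself, continuous for the metric $\max_i|e^{x_i}-e^{y_i}|$, $r(f)=\max\{\lambda\in\mathbb{R}_{\max}\mid\exists x\in\mathbb{R}_{\max}^n,\ x\not\equiv-\infty,\ \lambda+x=f(x)\}$. For $\lambda\in\mathbb{R}$ let $h_\lambda(x)=(\lambda+A^{\sharp}Bx)\wedge(-\lambda+B^{\sharp}Ax)$; the spectral function of $(A,B)$ is $s(\lambda):=r(h_\lambda)$, $\lambda\in\mathbb{R}$. Further, $$\Delta(A,B)=\max\Big(\max_{i,j,k:\,a_{ij}\ne-\infty,\,b_{ik}\ne-\infty}(a_{ij}-b_{ik}),\ \max_{i,j,k:\,b_{ij}\ne-\infty,\,a_{ik}\ne-\infty}(b_{ij}-a_{ik})\Big),$$ $$\overline{C}(A,B)=\max_{i,j,k:\,a_{ij}\ne-\infty,\,b_{ik}\ne-\infty}(a_{ij}-b_{ik}),\qquad \underline{C}(A,B)=\min_{i,j,k:\,a_{ik}\ne-\infty,\,b_{ij}\ne-\infty}(a_{ik}-b_{ij}).$$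 *)

(* Defs.v *)
From HB Require Import structures.
From mathcomp Require Import all_boot all_order all_algebra.
From mathcomp Require Import all_classical all_reals.

Set Implicit Arguments.
Unset Strict Implicit.
Unset Printing Implicit Defensive.

Import Order.TTheory GRing.Theory Num.Theory.

Local Open Scope classical_set_scope.
Local Open Scope ring_scope.
Local Open Scope ereal_scope.

(* R_max = R U {-oo} is the part of \bar R without +oo. The +oo of \bar R is
   needed as well: A^# y has value +oo at j when column j of A is -oo. *)
Definition Rmax_mx (R : realType) (m n : nat) (A : 'M[\bar R]_(m, n)) : Prop :=
  forall i j, A i j != +oo.

Definition maxplus_app (R : realType) (m n : nat)
    (A : 'M[\bar R]_(m, n)) (x : 'cV[\bar R]_n) : 'cV[\bar R]_m :=
  \col_i \big[maxe/-oo]_(j < n) (A i j + x j 0%R).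

(* The dual addition of \bar R satisfies -oo + +oo = +oo, as is required here;
   the usual one satisfies -oo + +oo = -oo. *)
Definition sharp_app (R : realType) (m n : nat)
    (A : 'M[\bar R]_(m, n)) (y : 'cV[\bar R]_m) : 'cV[\bar R]_n :=
  \col_j \big[mine/+oo]_(i < m) (- A i j + y i 0%R)%dE.

Definition sharp_comp (R : realType) (m n : nat) (A B : 'M[\bar R]_(m, n))
    (x : 'cV[\bar R]_n) : 'cV[\bar R]_n :=
  sharp_app A (maxplus_app B x).

Definition shift_app (R : realType) (n : nat) (a : \bar R) (x : 'cV[\bar R]_n) :
    'cV[\bar R]_n :=
  \col_j (a + x j 0%R).

Definition eigenvalues (R : realType) (n : nat)
    (f : 'cV[\bar R]_n -> 'cV[\bar R]_n) : set (\bar R) :=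
  [set a | a != +oo /\ exists x : 'cV[\bar R]_n,
     [/\ Rmax_mx x, exists j, x j 0%R != -oo & shift_app a x = f x]].

(* The greatest element (a maximum, not merely a supremum) of the eigenvalues;
   it exists for order-preserving, additively homogeneous and continuous
   self-maps of R_max^n. The value -oo is a default where there is none. *)
Definition spectral_radius (R : realType) (n : nat)
    (f : 'cV[\bar R]_n -> 'cV[\bar R]_n) : \bar R :=
  xget -oo (eigenvalues f `&` ubound (eigenvalues f)).

Definition spectral_map (R : realType) (m n : nat) (A B : 'M[\bar R]_(m, n))
    (lam : R) (x : 'cV[\bar R]_n) : 'cV[\bar R]_n :=
  map2_mx mine (shift_app lam%:E (sharp_comp A B x))
               (shift_app (- lam%:E) (sharp_comp B A x)).

Definition spectral_function (R : realType) (m n : nat)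
    (A B : 'M[\bar R]_(m, n)) (lam : R) : \bar R :=
  spectral_radius (spectral_map A B lam).

Definition Cupper (R : realType) (m n : nat) (A B : 'M[\bar R]_(m, n)) : \bar R :=
  \big[maxe/-oo]_(i < m) \big[maxe/-oo]_(j < n | A i j != -oo)
    \big[maxe/-oo]_(k < n | B i k != -oo) (A i j - B i k).

Definition Clower (R : realType) (m n : nat) (A B : 'M[\bar R]_(m, n)) : \bar R :=
  \big[mine/+oo]_(i < m) \big[mine/+oo]_(k < n | A i k != -oo)
    \big[mine/+oo]_(j < n | B i j != -oo) (A i k - B i j).

Definition Delta (R : realType) (m n : nat) (A B : 'M[\bar R]_(m, n)) : \bar R :=
  maxe (Cupper A B) (Cupper B A).

(* Main.v *)
(* The map [h_lam] is the dynamic programming operator of a deterministic mean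
   payoff game. If every cycle of some positional strategy of Min has mean at most
   [v], there is a real [y] with [h y <= v + y]; the iterates of [h - v] from [y]
   then decrease to an eigenvector, unless they all tend to [-oo], in which case
   some positional strategy of Min makes all cycle means smaller than [v]. Hence
   [s(lam)] is a finite min-max of cycle means, i.e. of lines
   [alpha + (1 - 2 t / l) lam] with [|alpha| <= Delta] and [t <= l <= kappa]. Two
   such lines of distinct slopes cross at some [|lam| <= kappa^2 Delta], or
   [|lam| <= kappa Delta] if one slope is 1, so on the left of these thresholds
   the min-max is attained by a fixed line. Its slope is nonnegative since
   [s <= 0]. The right half follows by exchanging [A] and [B]. *)
Require Import Defs.
From HB Require Import structures.
From mathcomp Require Import all_boot all_order all_algebra.
From mathcomp Require Import all_classical all_reals.
From mathcomp Require Import ereal.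
From mathcomp Require Import zify lra ring.

Import Order.TTheory GRing.Theory Num.Theory.

Local Open Scope ring_scope.

(** * Orbits of a finite map: weights and short cycles *)

Lemma pigeonhole (T : finType) (u : nat -> T) :
  exists a b, [/\ (a < b)%N, (b <= #|T|)%N & u a = u b].
Proof.
have /injectivePn[i [j ij uij]] : ~~ injectiveb (fun i : 'I_#|T|.+1 => u i).
  apply/negP => /injectiveP /leq_card.
  by rewrite card_ord ltnn.
move: ij; rewrite neq_lt => /orP[] ij; [exists i, j|exists j, i];
  by split; rewrite // -ltnS.
Qed.

Section CycleSums.
Context {R : realType} {P : Type} (g : P -> P) (W : P -> R).

Definition orbit_sum (l : nat) (p : P) : R := \sum_(s < l) W (iter s g p).

Lemma orbit_sumS l p : orbit_sum l.+1 p = W p + orbit_sum l (g p).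
Proof.
rewrite /orbit_sum big_ord_recl /=; congr (_ + _).
by apply: eq_bigr => s _; rewrite -iterSr.
Qed.

Lemma orbit_sumD a b p : orbit_sum (a + b) p = orbit_sum a p + orbit_sum b (iter a g p).
Proof.
elim: a p => [|a IH] p; first by rewrite /orbit_sum big_ord0 add0r.
by rewrite addSn !orbit_sumS IH addrA iterSr.
Qed.

(** The invariant [Q] confines the orbit to positions where the one-step inequality is available. On
    a cycle the two [u] terms cancel, which bounds the cycle sum. *)
Lemma orbit_sum_telescope (u : P -> R) (e : R) (Q : P -> Prop) l p :
  (forall p, Q p -> Q (g p)) -> (forall p, Q p -> W p + u (g p) <= u p - e) -> Q p ->
  orbit_sum l p + u (iter l g p) <= u p - e *+ l.
Proof.
move=> Qg Wu; elim: l p => [|l IH] p Qp.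
  by rewrite /orbit_sum big_ord0 add0r mulr0n subr0.
rewrite orbit_sumS iterSr mulrS.
have := IH _ (Qg _ Qp); have := Wu _ Qp; lra.
Qed.

End CycleSums.

Lemma orbit_sumN (R : realType) (P : Type) (g : P -> P) (W : P -> R) l p :
  orbit_sum g (fun q => - W q) l p = - orbit_sum g W l p.
Proof. by rewrite /orbit_sum sumrN. Qed.

Lemma orbit_sum_cyc {R : realType} {P : Type} {g : P -> P} (W : P -> R) l p :
  iter l g p = p -> orbit_sum g (W \o g) l p = orbit_sum g W l p.
Proof.
case: l => [|l] lp; first by rewrite /orbit_sum !big_ord0.
rewrite /orbit_sum big_ord_recr [RHS]big_ord_recl /= addrC -iterS lp; congr (_ + _).
Qed.

Section Cycles.
Context {P : finType} {n : nat} (sigma : 'I_n -> P) (tau : P -> 'I_n).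

(** The orbit alternates between [P] and ['I_n], so a repetition can be sought in the smaller set. A
    repeated column only fixes the position one step later, hence the start [a.+1] and the bound
    with [.+1]. *)
Lemma cycle_exists p : exists a l, [/\ (0 < l)%N, (l <= minn #|P| n)%N,
  (a + l <= (minn #|P| n).+1)%N &
  iter l (sigma \o tau) (iter a (sigma \o tau) p) = iter a (sigma \o tau) p].
Proof.
case: (leqP #|P| n) => [Pn|/ltnW nP].
  have [a [b [ab bP e]]] := pigeonhole P (fun s => iter s (sigma \o tau) p).
  exists a, (b - a)%N; split; [lia|lia|lia|].
  by rewrite -iterD subnK // ltnW.
have [a [b [ab bP e]]] := pigeonhole 'I_n (fun s => tau (iter s (sigma \o tau) p)).
rewrite card_ord in bP.
exists a.+1, (b - a)%N; split; [lia|lia|lia|].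
rewrite -iterD addnS subnK; last exact: ltnW.
by rewrite !iterS /= e.
Qed.
End Cycles.

(** * One-player games: potentials from nonpositive cycles *)

(* Potentials of the one-player game in which Min plays [sigma]; [E p] is the
   set of moves of Max at [p]. *)
Section Potential.
Context {R : realType} {P : finType} {n : nat} (sigma : 'I_n -> P).
Variable W : P -> 'I_n -> R.

Definition nonpos_cycles (E : P -> {set 'I_n}) := forall tau : P -> 'I_n,
  (forall p, tau p \in E p) -> forall p l, (0 < l)%N -> (l <= minn #|P| n)%N ->
  iter l (sigma \o tau) p = p -> orbit_sum (sigma \o tau) (fun p => W p (tau p)) l p <= 0.

(** The potential at [p] is the largest weight of an initial segment of the orbit of [p], of length
    at most [N]. Prepending a step may give length [N.+1], but such a segment contains a cycle that
    can be removed. *)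
Lemma potential_strategy (tau : P -> 'I_n) :
  (forall p l, (0 < l)%N -> (l <= minn #|P| n)%N ->
  iter l (sigma \o tau) p = p -> orbit_sum (sigma \o tau) (fun p => W p (tau p)) l p <= 0) ->
  exists q : P -> R, forall p, W p (tau p) + q (sigma (tau p)) <= q p.
Proof.
move=> cyc; set N := minn #|P| n; set g := sigma \o tau.
set S := orbit_sum g (fun p => W p (tau p)).
exists (fun p => \big[Num.max/0]_(t < N.+1) S t p) => p.
rewrite -lerBrDl.
suff Sq t : (t <= N)%N -> S t (g p) <= \big[Num.max/0]_(t < N.+1) S t p - W p (tau p).
  apply: bigmax_le => [|t _]; last by apply: Sq; rewrite -ltnS.
  by have := Sq 0%N (leq0n _); rewrite /S /orbit_sum big_ord0.
move=> tN; rewrite lerBrDl -orbit_sumS -/S.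
move: tN; rewrite leq_eqVlt => /predU1P[->|tN]; last first.
  by apply: (le_bigmax 0 (fun t : 'I_N.+1 => S t p) (Ordinal (tN : (t.+1 < N.+1)%N))).
(* Cutting out the cycle of length [l] leaves a segment of length [N.+1 - l], and its weight is at
   least as large because the cycle has weight at most 0. *)
have [a [l [l0 lN alN e]]] := cycle_exists sigma tau p.
have lt : (N.+1 - l < N.+1)%N by lia.
apply: le_trans (le_bigmax 0 (fun t : 'I_N.+1 => S t p) (Ordinal lt)) => /=.
have -> : N.+1 = (a + (l + (N.+1 - l - a)))%N by lia.
have -> : (a + (l + (N.+1 - l - a)) - l = a + (N.+1 - l - a))%N by lia.
rewrite /S !orbit_sumD e lerD2l gerDr; exact: cyc.
Qed.

(* Splitting the moves at [p0] into two parts, the minimum of two potentials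
   that agree at [p0] is a potential for the union. *)
Lemma potential_exists (E : P -> {set 'I_n}) : (forall p, E p != finset.set0) ->
  nonpos_cycles E ->
  exists q : P -> R, forall p k, k \in E p -> W p k + q (sigma k) <= q p.
Proof.
(* Induction on the total number of moves; when every position has a single move, only one strategy
   [tau] is left. *)
have [N] := ubnP (\sum_p #|E p|); elim: N E => // N IH E EN E0 cyc.
have [/existsP[p0 p01]|/existsPn sing] := boolP [exists p, (1 < #|E p|)%N]; last first.
  have Ek p : exists k, E p == [set k]%SET.
    have /cards1P[k ->] : #|E p| == 1%N by rewrite eqn_leq leqNgt sing card_gt0 E0.
    by exists k.
  pose tau p := xchoose (Ek p).
  have Etau p : E p = [set tau p]%SET by apply/eqP/(xchooseP (Ek p)).
  have [|q qP] := potential_strategy tau.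
    by apply: cyc => p; rewrite Etau inE.
  by exists q => p k; rewrite Etau inE => /eqP ->.
have /card_gt0P[k0 k0E] := ltnW p01.
(* Moves at [p0] are restricted to [F], all others are kept. Subtracting [q p0] makes the potentials
   of the two parts agree at [p0]. *)
have split (F : {set 'I_n}) : F \proper E p0 -> F != finset.set0 ->
    exists q : P -> R, q p0 = 0 /\ forall p k, k \in E p -> (p = p0 -> k \in F) ->
      W p k + q (sigma k) <= q p.
  move=> FE F0; pose E' p := if p == p0 then F else E p.
  have sub p : E' p \subset E p by rewrite /E'; case: eqP => // ->; apply: proper_sub.
  have [|p|tau tE|q qP] := IH E'.
  - rewrite -ltnS; apply: leq_trans EN; rewrite ltnS (bigD1 p0) //= [ltnRHS](bigD1 p0) //=.
    rewrite -addSn leq_add //; first by rewrite /E' eqxx proper_card.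
    by apply: leq_sum => p _; apply: subset_leq_card.
  - by rewrite /E'; case: ifP => _; [exact: F0|exact: E0].
  - by apply: (cyc tau) => p; exact: (fintype.subsetP (sub p) _ (tE p)).
  exists (fun p => q p - q p0); split=> [|p k kE kF]; first by rewrite subrr.
  rewrite addrA lerD2r; apply: qP; rewrite /E'.
  by case: eqP => // /kF.
have [||q1 [q10 q1P]] := split [set k0]%SET.
- by rewrite properEcard cards1 p01 finset.sub1set k0E.
- by apply/finset.set0Pn; exists k0; rewrite inE.
have [||q2 [q20 q2P]] := split (E p0 :\ k0).
- exact: properD1.
- by rewrite -card_gt0; move: p01; rewrite (cardsD1 k0) k0E.
exists (fun p => Num.min (q1 p) (q2 p)) => p k kE.
have H1 := q1P p k kE; have H2 := q2P p k kE.
have [pp|/eqP pp] := eqVneq p p0; last first.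
  move: (H1 (fun h => False_ind _ (pp h))) (H2 (fun h => False_ind _ (pp h))) => {}H1 {}H2.
  rewrite le_min; apply/andP; split; [apply: le_trans H1|apply: le_trans H2];
    by rewrite lerD2l ge_min lexx ?orbT.
subst p; rewrite q10 q20 minxx; have [kk|kk] := eqVneq k k0.
  rewrite -q10; apply: le_trans (H1 _); first by rewrite lerD2l ge_min lexx.
  by rewrite inE kk.
rewrite -q20; apply: le_trans (H2 _); first by rewrite lerD2l ge_min lexx orbT.
by move=> _; rewrite !inE kk.
Qed.
End Potential.

(** * Two-player games and their dynamic programming maps *)

(* A mean payoff game: at [j] the minimizer pays [- c p j] and moves to some [p]
   with [cA p j]; at [p] the maximizer receives [d p k] and moves to some [k]
   with [dA p k]. *)
Section Game.
Context {R : realType} {P : finType} {n : nat}.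
Variables (cA dA : P -> 'I_n -> bool) (c d : P -> 'I_n -> R).

(** The payment charged is that of the next move of Min, so a cycle in [P] counts each reward and
    each payment once. *)
Definition step_weight (sigma : 'I_n -> P) (tau : P -> 'I_n) (p : P) : R :=
  d p (tau p) - c (sigma (tau p)) (tau p).

Definition is_cycle (sigma : 'I_n -> P) (tau : P -> 'I_n) (l : nat) (p : P) : bool :=
  [&& (0 < l)%N, (l <= minn #|P| n)%N & iter l (sigma \o tau) p == p].

Definition cycle_sum (sigma : 'I_n -> P) (tau : P -> 'I_n) (l : nat) (p : P) : R :=
  orbit_sum (sigma \o tau) (step_weight sigma tau) l p.

(** [value_ge] and [value_le] bound the min over [sigma] of the max over [tau] of the cycle means,
    in this order. Only short cycles enter, and every orbit reaches one; [v *+ l] avoids dividing by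
    the length. *)
Definition value_ge (v : R) : Prop :=
  forall sigma : 'I_n -> P, (forall j, cA (sigma j) j) ->
  exists tau : P -> 'I_n, (forall p, dA p (tau p)) /\
  exists l p, is_cycle sigma tau l p /\ v *+ l <= cycle_sum sigma tau l p.

Definition value_le (v : R) : Prop :=
  exists sigma : 'I_n -> P, (forall j, cA (sigma j) j) /\
  forall tau : P -> 'I_n, (forall p, dA p (tau p)) ->
  forall l p, is_cycle sigma tau l p -> cycle_sum sigma tau l p <= v *+ l.

(** Together the clauses say that [f x j] is the min over [p] of the max over [k] of
    [d p k - c p j + x k], with the min attained. *)
Definition game_map (f : 'cV[\bar R]_n -> 'cV[\bar R]_n) : Prop :=
  forall x, Rmax_mx x -> forall j,
  (forall p, cA p j -> exists k, dA p k /\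
     (f x j 0%R <= (d p k - c p j)%:E + x k 0%R)%E) /\
  (exists p, cA p j /\ forall k, dA p k ->
     ((d p k - c p j)%:E + x k 0%R <= f x j 0%R)%E).

Hypothesis dA_ex : forall p, exists k, dA p k.
Variable f : 'cV[\bar R]_n -> 'cV[\bar R]_n.
Hypothesis fP : game_map f.

(** Min plays the strategy given by [value_le v], Max the best reply to [x]. Along the play [x]
    stays finite, and telescoping on the cycle reached gives [mu *+ l <= cycle_sum <= v *+ l]. *)
Lemma sub_eigenvalue_le v mu (x : 'cV[\bar R]_n) : value_le v -> Rmax_mx x ->
  (exists j, x j 0%R != -oo%E) -> (forall j, (mu%:E + x j 0%R <= f x j 0%R)%E) -> mu <= v.
Proof.
move=> [sigma [sigmaP sv]] xR [j0 xj0] fx.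
pose k0 p := xchoose (dA_ex p).
have k0P p : dA p (k0 p) by exact: xchooseP.
pose tau p := [arg max_(k > k0 p | dA p k) ((d p k)%:E + x k 0%R)%E]%O.
have tauP p : dA p (tau p) by rewrite /tau; case: arg_maxP.
have tau_max p k : dA p k -> ((d p k)%:E + x k 0%R <= (d p (tau p))%:E + x (tau p) 0%R)%E.
  by rewrite /tau; case: arg_maxP => // ? ? H /H.
have tau_le j : (mu%:E + x j 0%R <=
    (d (sigma j) (tau (sigma j)) - c (sigma j) j)%:E + x (tau (sigma j)) 0%R)%E.
  have [+ _] := fP _ xR j; move=> /(_ _ (sigmaP j))[k [dk fk]].
  apply: le_trans (fx j) _; apply: le_trans fk _.
  by rewrite ![_ - c _ _]addrC !EFinD -!addeA leeD2l // tau_max.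
have step j : x j 0%R != -oo%E -> x (tau (sigma j)) 0%R != -oo%E /\
    mu + fine (x j 0%R) <=
    d (sigma j) (tau (sigma j)) - c (sigma j) j + fine (x (tau (sigma j)) 0%R).
  have := tau_le j; have := xR j 0; have := xR (tau (sigma j)) 0.
  by case: (x j 0%R) => [?||] //; case: (x (tau (sigma j)) 0%R) => [?||] //.
set g := sigma \o tau.
pose Q p := x (tau p) 0%R != -oo%E.
have Qg p : Q p -> Q (g p) by move=> /step[].
have Q0 : Q (sigma j0) by have [] := step _ xj0.
have [a [l [l0 lN _ cyc]]] := cycle_exists sigma tau (sigma j0).
set p := iter a _ _ in cyc.
have Qp : Q p by rewrite /p; elim: (a) => //= b; exact: Qg.
(* The reward is included in [u] because a step weight pairs the reward at [q] with the payment at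
   the next position. Signs are reversed to turn the telescoping bound into a lower bound. *)
pose u p := d p (tau p) + fine (x (tau p) 0%R).
have H q : Q q -> - step_weight sigma tau q - u (g q) <= - u q - mu.
  by move=> /step[_]; rewrite /u /step_weight /g /=; lra.
have := orbit_sum_telescope g (fun q => - step_weight sigma tau q) (fun q => - u q)
  mu Q l p Qg H Qp.
rewrite cyc orbit_sumN -/(cycle_sum sigma tau l p) => sum_ge.
have sum_le : cycle_sum sigma tau l p <= v *+ l.
  by apply: sv => //; rewrite /is_cycle l0 lN cyc eqxx.
suff : mu *+ l <= v *+ l by rewrite lerMn2r gtn_eqF.
lra.
Qed.

(** Fixing the strategy of Min leaves a one-player game without positive cycles. Its potential lives
    on [P]; subtracting the payment of Min carries it to columns. *)
Lemma super_solution : value_le 0 ->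
  exists y : 'I_n -> R, forall j, (f (\col_i (y i)%:E) j 0%R <= (y j)%:E)%E.
Proof.
move=> [sigma [sigmaP sv]].
pose W p k := d p k - c (sigma k) k.
have [p||q qP] := @potential_exists R P n sigma W (fun p => [set k | dA p k]%SET).
- by have [k pk] := dA_ex p; apply/finset.set0Pn; exists k; rewrite inE.
- move=> tau tauE p l l0 lN cyc; rewrite -(mul0rn R l); apply: sv.
    by move=> q; have := tauE q; rewrite inE.
  by rewrite /is_cycle l0 lN cyc eqxx.
exists (fun j => q (sigma j) - c (sigma j) j) => j.
have yR : Rmax_mx (\col_i (q (sigma i) - c (sigma i) i)%:E) by move=> i i'; rewrite mxE.
have [+ _] := fP _ yR j; move=> /(_ _ (sigmaP j))[k [dk]]; rewrite mxE => /le_trans; apply.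
rewrite -EFinD lee_fin; have := qP (sigma j) k; rewrite inE => /(_ dk).
by rewrite /W; lra.
Qed.

(** The moves of Min that attain [f z] form a strategy against which every cycle of length [l] has
    sum at most [- e *+ l], contrary to [value_ge 0]. *)
Lemma strict_super_solution_absurd (z : 'I_n -> R) (e : R) : value_ge 0 -> 0 < e ->
  (forall j, (f (\col_i (z i)%:E) j 0%R <= (z j - e)%:E)%E) -> False.
Proof.
move=> vge e0 fz.
have zR : Rmax_mx (\col_i (z i)%:E) by move=> i i'; rewrite mxE.
have ex j := (fP _ zR j).2.
pose sigma j := projT1 (cid (ex j)).
have sigmaP j : cA (sigma j) j by rewrite /sigma; case: cid => p [].
have sigma_le j k : dA (sigma j) k -> d (sigma j) k - c (sigma j) j + z k <= z j - e.
  rewrite /sigma; case: cid => p [_ /= H] dk; rewrite -lee_fin.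
  by apply: le_trans (fz j); have := H _ dk; rewrite mxE EFinD.
have [tau [tauP [l [p [/and3P[l0 _ /eqP cyc]]]]]] := vge sigma sigmaP.
rewrite mul0rn => sum0.
pose u p := d p (tau p) + z (tau p).
have H q : xpredT q ->
    step_weight sigma tau q + u ((sigma \o tau) q) <= u q - e.
  by have := sigma_le _ _ (tauP (sigma (tau q))); rewrite /u /step_weight /=; lra.
have := orbit_sum_telescope (sigma \o tau) (step_weight sigma tau) u e xpredT l p
  (fun _ _ => isT) H isT.
rewrite cyc -/(cycle_sum sigma tau l p).
by have : 0 < e *+ l; [rewrite pmulrn_lgt0|move: sum0; lra].
Qed.

Lemma game_map_Rmax (x : 'cV[\bar R]_n) : Rmax_mx x -> Rmax_mx (f x).
Proof.
move=> xR i j; rewrite (ord1 j).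
have [f_le [p [cp _]]] := fP _ xR i; have [k [_ H]] := f_le p cp.
apply: contra_neq (xR k 0) => fx; move: H; rewrite fx leye_eq => /eqP.
by case: (x k 0%R).
Qed.

Lemma game_map_fin (x : 'cV[\bar R]_n) : (forall j, x j 0%R \is a fin_num) ->
  forall j, f x j 0%R \is a fin_num.
Proof.
move=> xF j.
have xR : Rmax_mx x by move=> i i'; rewrite (ord1 i'); have := xF i; case: (x i 0%R).
have [_ [p [_ H]]] := fP _ xR j; have [k dk] := dA_ex p.
rewrite fin_numE game_map_Rmax // andbT.
have := H _ dk; have := xF k; case: (x k 0%R) => // r _.
by case: (f x j 0%R).
Qed.

Lemma game_map_le (x y : 'cV[\bar R]_n) : Rmax_mx x -> Rmax_mx y ->
  (forall j, x j 0%R <= y j 0%R)%E -> forall j, (f x j 0%R <= f y j 0%R)%E.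
Proof.
move=> xR yR xy j; have [_ [p [cp H]]] := fP _ yR j.
have [+ _] := fP _ xR j; move=> /(_ p cp)[k [dk /le_trans]]; apply.
by apply: le_trans (H _ dk); rewrite leeD2l.
Qed.

Lemma game_map_shift_le (x : 'cV[\bar R]_n) (e : R) : Rmax_mx x ->
  forall j, (f (\col_i (x i 0%R + e%:E)) j 0%R <= f x j 0%R + e%:E)%E.
Proof.
move=> xR j; have [_ [p [cp H]]] := fP _ xR j.
have xeR : Rmax_mx (\col_i (x i 0%R + e%:E)%E).
  by move=> i i'; rewrite mxE; have := xR i 0; case: (x i 0%R).
have [+ _] := fP _ xeR j; move=> /(_ p cp)[k [dk /le_trans]]; apply.
by rewrite mxE addeA leeD2r // H.
Qed.

(** * The decreasing orbit of a super-solution and its limit *)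

Section Orbit.
Variable y : 'I_n -> R.
Hypothesis fy : forall j, (f (\col_i (y i)%:E) j 0%R <= (y j)%:E)%E.

Let X (N : nat) : 'cV[\bar R]_n := iter N f (\col_i (y i)%:E).

Let X_fin N j : X N j 0%R \is a fin_num.
Proof.
elim: N j => [|N IH] j; first by rewrite mxE.
by rewrite /X iterS -/(X N) game_map_fin.
Qed.

Let X_Rmax N : Rmax_mx (X N).
Proof. by move=> j i; rewrite (ord1 i); have := X_fin N j; case: (X N j 0%R). Qed.

Let X_decr N j : (X N.+1 j 0%R <= X N j 0%R)%E.
Proof.
elim: N j => [|N IH] j; first by rewrite [leRHS]mxE; exact: fy.
exact: (game_map_le _ _ (X_Rmax N.+1) (X_Rmax N) IH j).
Qed.

Let X_homo j : {homo (fun N => X N j 0%R) : M N / (M <= N)%N >-> (N <= M)%E}.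
Proof.
move=> M N MN; rewrite -(subnK MN); elim: (N - M)%N => //= K.
by move=> /(le_trans (X_decr _ _)); apply.
Qed.

Let x : 'cV[\bar R]_n := \col_j ereal_inf [set X N j 0%R | N in setT].

Let x_le N j : (x j 0%R <= X N j 0%R)%E.
Proof. by rewrite mxE; apply: ereal_inf_lbound; exists N. Qed.

Let x_Rmax : Rmax_mx x.
Proof.
move=> j i; rewrite (ord1 i); have := x_le 0 j; rewrite [X 0%N _ _]mxE.
by case: (x j 0%R).
Qed.

Let x_lt j (t : \bar R) : (x j 0%R < t)%E -> exists N, (X N j 0%R < t)%E.
Proof. by rewrite mxE => /ereal_inf_lt[_ [N _ <-] H]; exists N. Qed.

(** There are finitely many columns and the orbit decreases, so the largest of the individual times
    serves all of them. *)
Let x_lt_uniform (S : pred 'I_n) (t : 'I_n -> \bar R) :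
  (forall k, S k -> (x k 0%R < t k)%E) -> exists N, forall k, S k -> (X N k 0%R < t k)%E.
Proof.
move=> H; have ex k : exists N, S k -> (X N k 0%R < t k)%E.
  by case: (boolP (S k)) => [/H/x_lt[N NP]|_]; [exists N|exists 0%N].
exists (\max_k projT1 (cid (ex k))) => k Sk.
apply: le_lt_trans (projT2 (cid (ex k)) Sk).
by apply: X_homo; exact: leq_bigmax.
Qed.

(** Monotonicity gives [f x <= x]. If [f x j < x j], let Min play the optimal [p] at [j]: every
    reply of Max is below [x j] already for some [X N], which forces [X N.+1 j < x j], impossible
    for an infimum. *)
Let x_fixed : f x = x.
Proof.
apply/colP => j; apply/eqP; rewrite eq_le; apply/andP; split.
  rewrite [leRHS]mxE; apply/ereal_infP => _ [N _ <-].
  apply: le_trans (X_decr N j); exact: (game_map_le x (X N)).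
have [_ [p [cp H]]] := fP _ x_Rmax j.
rewrite leNgt; apply/negP => fx.
have xj : x j 0%R \is a fin_num.
  by have := x_Rmax j 0; move: (fx); case: (x j 0%R) => //; rewrite ltNge leNye.
have [N XN] : exists N, forall k, dA p k -> (X N k 0%R < x j 0%R - (d p k - c p j)%:E)%E.
  apply: x_lt_uniform => k /H Hk; rewrite lteBrDl //.
  exact: le_lt_trans Hk fx.
have [+ _] := fP _ (X_Rmax N) j; move=> /(_ p cp)[k [dk]].
have := XN k dk; rewrite lteBrDl // => lt1 fle; have := le_lt_trans fle lt1.
by rewrite ltNge (x_le N.+1 j).
Qed.

(** If the limit of the orbit has a finite coordinate, it is the fixed point. Otherwise all
    coordinates fall below [y - 1] at a common time, and this drop is spread evenly over the steps
    of the orbit. *)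
Lemma fixed_point_or_strict : (0 < n)%N ->
  (exists x, [/\ Rmax_mx x, exists j, x j 0%R != -oo%E & f x = x]) \/
  (exists (z : 'I_n -> R) (e : R), 0 < e /\
     forall j, (f (\col_i (z i)%:E) j 0%R <= (z j - e)%:E)%E).
Proof.
move=> n0; case: (pselect (exists j, x j 0%R != -oo%E)) => [xj|xN].
  by left; exists x; split=> //; exact: x_fixed.
right; have {}xN j : x j 0%R = -oo%E.
  by have [->|xj] := eqVneq (x j 0%R) -oo%E; last by case: xN; exists j.
have [N XN] : exists N, forall j, predT j -> (X N j 0%R < (y j - 1)%:E)%E.
  by apply: x_lt_uniform => j _; rewrite xN ltNyr.
pose e : R := (N.+1%:R)^-1.
have e0 : 0 < e by rewrite invr_gt0 ltr0n.
have eN : N.+1%:R * e = 1 by rewrite mulfV // pnatr_eq0.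
(* The ladder [min_(s <= N) (f^s y + s e)] moves down by [e] under [f], since
   [f^N.+1 y + N e <= y - e]. *)
pose Z s j := fine (X s j 0%R) + s%:R * e.
exists (fun j => \big[Num.min/Z 0%N j]_(s < N.+1) Z s j), e; split=> // j.
set z := fun j => \big[Num.min/Z 0%N j]_(s < N.+1) Z s j.
have zZ s i : (s <= N)%N -> z i <= Z s i.
  by rewrite -ltnS => sN; exact: (bigmin_le (Z 0%N i) (Ordinal sN) (fun s : 'I_N.+1 => Z s i)).
have fz s : (s <= N)%N -> (f (\col_i (z i)%:E) j 0%R <= (Z s.+1 j - e)%:E)%E.
  move=> sN.
  apply: (@le_trans _ _ (f (\col_i (X s i 0%R + (s%:R * e)%:E)) j 0%R)).
    apply: game_map_le => [i i'|i i'|i]; rewrite ?mxE //.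
      by have := X_Rmax s i 0; case: (X s i 0%R).
    by rewrite -[X s i _]fineK // -EFinD lee_fin zZ.
  apply: le_trans (game_map_shift_le _ _ (X_Rmax s) j) _.
  rewrite -[f (X s)]/(X s.+1) -[X s.+1 j _]fineK // -EFinD lee_fin /Z.
  by rewrite -natr1 mulrDl mul1r addrA addrK.
(* The ladder closes: the bound for rung 0 comes from rung [N], where the accumulated [N.+1]
   increments [e] amount to exactly the drop 1. *)
have fz0 : (f (\col_i (z i)%:E) j 0%R <= (Z 0%N j - e)%:E)%E.
  apply: le_trans (fz N (leqnn N)) _; rewrite lee_fin lerD2r /Z mul0r addr0 eN.
  rewrite [X 0%N j _]mxE /=.
  have := XN j isT; have := X_decr N j; rewrite -[X N j _]fineK // -[X N.+1 j _]fineK //.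
  by rewrite lee_fin lte_fin; lra.
have ffin : f (\col_i (z i)%:E) j 0%R \is a fin_num by apply: game_map_fin => i; rewrite mxE.
rewrite -/z -(fineK ffin) lee_fin lerBrDr.
apply: le_bigmin => [|[[|s] sN] _ /=]; rewrite -lerBrDr -lee_fin fineK //.
by apply: fz; rewrite -ltnS; apply: ltnW.
Qed.

End Orbit.
End Game.

(** * Finite min-max and the eigenvalue of a game *)

Lemma finite_minimax (R : realType) (S U : finType) (vS : pred S) (vU : S -> pred U)
    (F : S -> U -> R) :
  (exists s, vS s) -> (forall s, vS s -> exists u, vU s u) ->
  exists s u, [/\ vS s, vU s u,
    forall s', vS s' -> exists u', vU s' u' /\ F s u <= F s' u' &
    forall u', vU s u' -> F s u' <= F s u].
Proof.
move=> [s0 vs0] exU; have [u0 _] := exU _ vs0.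
(* [best s] is a best reply to [s], and [s1] below minimises its value; min and max are not
   exchanged. The [odflt] provides the valid starting point that an arg max requires. *)
pose best s := [arg max_(u > odflt u0 [pick u | vU s u] | vU s u) F s u]%O.
have bestP s : vS s -> vU s (best s) /\ forall u, vU s u -> F s u <= F s (best s).
  move=> vs; rewrite /best; case: arg_maxP => [|u vu uP]; last by split.
  by case: pickP => //= none; have [u] := exU s vs; rewrite none.
pose s1 := [arg min_(s < s0 | vS s) F s (best s)]%O.
have [vs1 s1P] : vS s1 /\ forall s, vS s -> F s1 (best s1) <= F s (best s).
  by rewrite /s1; case: arg_minP => // s vs sP; split.
exists s1, (best s1); have [vb bP] := bestP _ vs1; split=> // s vs.
by exists (best s); split; [have [] := bestP _ vs|apply: s1P].
Qed.

Lemma spectral_radiusE (R : realType) (n : nat) (f : 'cV[\bar R]_n -> 'cV[\bar R]_n) v :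
  eigenvalues f v -> (forall w, eigenvalues f w -> (w <= v)%E) -> spectral_radius f = v.
Proof.
move=> fv ub; rewrite /spectral_radius; case: xgetP => [w _ [fw wub]|/(_ v)]; last first.
  by case; split.
by apply/eqP; rewrite eq_le ub // wub.
Qed.

Section GameRadius.
Context {R : realType} {P : finType} {n : nat}.
Variables (cA dA : P -> 'I_n -> bool) (c d : P -> 'I_n -> R).
Hypothesis n_gt0 : (0 < n)%N.
Hypothesis dA_ex : forall p, exists k, dA p k.

Definition cycle_mean (sigma : 'I_n -> P) (tau : P -> 'I_n) (l : nat) (p : P) : R :=
  cycle_sum c d sigma tau l p / l%:R.

Lemma cycle_mean_ge sigma tau l p v : is_cycle sigma tau l p ->
  (v <= cycle_mean sigma tau l p) = (v *+ l <= cycle_sum c d sigma tau l p).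
Proof. by case/and3P=> l0 _ _; rewrite ler_pdivlMr ?ltr0n // mulr_natr. Qed.

Lemma cycle_mean_le sigma tau l p v : is_cycle sigma tau l p ->
  (cycle_mean sigma tau l p <= v) = (cycle_sum c d sigma tau l p <= v *+ l).
Proof. by case/and3P=> l0 _ _; rewrite ler_pdivrMr ?ltr0n // mulr_natr. Qed.

(** Strategies become finite functions, and Max chooses a reply [tau] together with a cycle, so this
    is a min-max over finite sets. The value is thus the mean of an explicit cycle, which later
    yields an explicit line in [lam]. *)
Lemma value_exists : (forall j, exists p, cA p j) ->
  exists sigma tau l p, [/\ (forall j, cA (sigma j) j) /\ (forall q, dA q (tau q)),
    is_cycle sigma tau l p, value_ge cA dA c d (cycle_mean sigma tau l p) &
    value_le cA dA c d (cycle_mean sigma tau l p)].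
Proof.
move=> cA_ex.
pose K := minn #|P| n.
pose U : finType := ({ffun P -> 'I_n} * ('I_K.+1 * P))%type.
pose vS := [pred s : {ffun 'I_n -> P} | [forall j, cA (s j) j]].
pose vU (s : {ffun 'I_n -> P}) := [pred u : U |
  [forall q, dA q (u.1 q)] && is_cycle s u.1 u.2.1 u.2.2].
pose F (s : {ffun 'I_n -> P}) (u : U) := cycle_mean s u.1 u.2.1 u.2.2.
have finfunK (A : finType) (B : Type) (h : A -> B) : finfun h = h :> (A -> B).
  by apply/funext => a; rewrite ffunE.
have [||s [u [/forallP vs /andP[/forallP vt cyc] sP uP]]] := @finite_minimax R _ _ vS vU F.
- exists [ffun j => xchoose (cA_ex j)]; apply/forallP => j; rewrite ffunE.
  exact: (xchooseP (cA_ex j)).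
- move=> s _; pose t := [ffun q => xchoose (dA_ex q)].
  have [a [l [l0 lK _ cyc]]] := cycle_exists s t (s (Ordinal n_gt0)).
  exists (t, (inord l, iter a (s \o t) (s (Ordinal n_gt0)))); apply/andP; split.
    by apply/forallP => q; rewrite ffunE; exact: (xchooseP (dA_ex q)).
  by rewrite /is_cycle /= inordK ?l0 ?lK //= cyc.
exists s, u.1, u.2.1, u.2.2; split=> //.
- move=> sigma sigmaP.
  have [|[t [l p]] [/andP[/= /forallP tP cyc'] le]] := sP (finfun sigma).
    by apply/forallP => j; rewrite ffunE.
  rewrite finfunK in cyc'; exists t; split=> //; exists l, p; split=> //.
  by rewrite -cycle_mean_ge //; rewrite /F /= finfunK in le.
- exists s; split=> // tau tauP l p cyc'.
  have lK : (l < K.+1)%N by case/and3P: cyc'.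
  have /= := uP (finfun tau, (Ordinal lK, p)); rewrite /F /= finfunK cycle_mean_le //.
  by apply; rewrite cyc' andbT; apply/forallP.
Qed.

Variable f : 'cV[\bar R]_n -> 'cV[\bar R]_n.
Hypothesis fP : game_map cA dA c d f.

Lemma game_fixed_point : value_ge cA dA c d 0 -> value_le cA dA c d 0 ->
  exists x, [/\ Rmax_mx x, exists j, x j 0%R != -oo%E & f x = x].
Proof.
move=> vge vle; have [y fy] := super_solution _ _ _ _ dA_ex _ fP vle.
case: (fixed_point_or_strict _ _ _ _ dA_ex _ fP _ fy n_gt0) => // - [z [e [e0 fz]]].
by case: (strict_super_solution_absurd _ _ _ _ _ fP _ _ vge e0 fz).
Qed.

End GameRadius.

Lemma cycle_sum_shift (R : realType) (P : finType) (n : nat) (c d : P -> 'I_n -> R) v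
    sigma tau l p :
  cycle_sum (fun p j => c p j + v) d sigma tau l p = cycle_sum c d sigma tau l p - v *+ l.
Proof.
rewrite /cycle_sum /orbit_sum -[in v *+ l](card_ord l) -sumr_const -sumrB.
by apply: eq_bigr => s _; rewrite /step_weight opprD addrA.
Qed.

(** Adding [v] to all payments reduces existence to a fixed point of a game of value 0; maximality
    is [sub_eigenvalue_le]. The eigenvalue property is kept because its eigenvectors are used
    later. *)
Lemma game_spectral_radius {R : realType} {P : finType} {n : nat}
    {cA dA : P -> 'I_n -> bool} {c d : P -> 'I_n -> R}
    {f : 'cV[\bar R]_n -> 'cV[\bar R]_n} {v} :
  (0 < n)%N -> (forall p, exists k, dA p k) -> game_map cA dA c d f ->
  value_ge cA dA c d v -> value_le cA dA c d v ->
  eigenvalues f v%:E /\ (forall w, eigenvalues f w -> (w <= v%:E)%E).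
Proof.
move=> n0 dA_ex fP vge vle; split; last first.
  move=> [w| |] [// _ [x [xR xN xf]]]; last by rewrite leNye.
  rewrite lee_fin; apply: (sub_eigenvalue_le _ _ _ _ dA_ex _ fP _ _ _ vle xR xN) => j.
  by rewrite -xf mxE.
pose g x : 'cV[\bar R]_n := \col_j (f x j 0%R - v%:E)%E.
have gP : game_map cA dA (fun p j => c p j + v) d g.
  have e p j k (t : \bar R) : ((d p k - (c p j + v))%:E + t = (d p k - c p j)%:E + t - v%:E)%E.
    by rewrite opprD addrA EFinB -addeA [((- v)%:E + t)%E]addeC addeA.
  move=> x xR j; have [f_le [p [cp f_ge]]] := fP x xR j; split.
    move=> q cq; have [k [dk fk]] := f_le q cq; exists k; split=> //.
    by rewrite mxE e leeD2r.
  by exists p; split=> // k dk; rewrite mxE e leeD2r // f_ge.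
have [||x [xR xN gx]] := game_fixed_point _ _ _ _ n0 dA_ex g gP.
- move=> sigma sP; have [tau [tP [l [p [cyc le]]]]] := vge sigma sP.
  exists tau; split=> //; exists l, p; split=> //.
  by rewrite cycle_sum_shift mul0rn subr_ge0.
- have [sigma [sP H]] := vle; exists sigma; split=> // tau tP l p cyc.
  by rewrite cycle_sum_shift mul0rn subr_le0 H.
split=> //; exists x; split=> //; apply/colP => j.
move/colP/(_ j): gx; rewrite !mxE => <-.
by rewrite addeC subeK.
Qed.

(** * The map [A^# B] as a game: Min picks a row, Max a column *)

Section SharpComp.
Context {R : realType} {m n : nat} (A B : 'M[\bar R]_(m, n)).
Hypotheses (A_Rmax : Rmax_mx A) (B_Rmax : Rmax_mx B).
Hypothesis B_rows : forall i, exists j, B i j != -oo%E.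

Lemma maxplus_app_Rmax x : Rmax_mx x -> Rmax_mx (maxplus_app B x).
Proof.
move=> xR i j; rewrite mxE -ltey; apply: bigmax_lt => [|k _]; first by rewrite ltNye.
by apply: lte_add_pinfty; rewrite ltey ?B_Rmax ?xR.
Qed.

Lemma dual_fin_addE (a : \bar R) (y : \bar R) : a \is a fin_num -> y != +oo%E ->
  (- a + y)%dE = ((- fine a)%:E + y)%E.
Proof. by case: a => // r _; case: y. Qed.

Lemma Rmax_fin i j : A i j != -oo%E -> A i j \is a fin_num.
Proof. by move=> Aij; rewrite fin_numE Aij A_Rmax. Qed.

Lemma sharp_comp_le x j i : Rmax_mx x -> A i j != -oo%E -> exists k, B i k != -oo%E /\
  (sharp_comp A B x j 0%R <= (fine (B i k) - fine (A i j))%:E + x k 0%R)%E.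
Proof.
move=> xR Aij; have [k0 Bk0] := B_rows i.
have [k Bk kmax] := @arg_maxP _ _ _ k0 (fun k => B i k != -oo%E)
  (fun k => B i k + x k 0%R)%E Bk0.
exists k; split=> //.
rewrite mxE; apply: le_trans (bigmin_le _ i _) _.
rewrite dual_fin_addE ?Rmax_fin //; last exact: maxplus_app_Rmax.
rewrite [fine (B i k) - _]addrC EFinD -addeA leeD2l // mxE.
apply: bigmax_le => [|k' _]; first exact: leNye.
have Bkf : B i k \is a fin_num by rewrite fin_numE Bk B_Rmax.
rewrite (fineK Bkf); have [->|Bk'] := eqVneq (B i k') -oo%E; first exact: leNye.
exact: kmax.
Qed.

Lemma le_sharp_comp x j : Rmax_mx x -> (exists i, A i j != -oo%E) ->
  exists i, A i j != -oo%E /\ forall k, B i k != -oo%E ->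
  ((fine (B i k) - fine (A i j))%:E + x k 0%R <= sharp_comp A B x j 0%R)%E.
Proof.
move=> xR [i0 Ai0].
have [i Ai imin] := @arg_minP _ _ _ i0 (fun i => A i j != -oo%E)
  (fun i => - A i j + maxplus_app B x i 0%R)%dE Ai0.
exists i; split=> // k Bk; rewrite mxE.
have yR i' : maxplus_app B x i' 0%R != +oo%E by exact: maxplus_app_Rmax.
apply: le_bigmin => [|i' _]; first exact: leey.
(* By the dual addition, a row with [A i' j = -oo] contributes [+oo] to the minimum. *)
have [Ai'|Ai'] := eqVneq (A i' j) -oo%E.
  by rewrite Ai'; case: (maxplus_app B x i' 0%R) => [?||]; rewrite leey.
apply: le_trans (imin _ Ai'); rewrite dual_fin_addE ?Rmax_fin //.
rewrite [fine (B i k) - _]addrC EFinD -addeA leeD2l //.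
have Bkf : B i k \is a fin_num by rewrite fin_numE Bk B_Rmax.
by rewrite (fineK Bkf) mxE; exact: (le_bigmax _ (fun k => B i k + x k 0%R)%E k).
Qed.

Lemma sharp_comp_game : (forall j, exists i, A i j != -oo%E) ->
  game_map (fun i j => A i j != -oo%E) (fun i j => B i j != -oo%E)
    (fun i j => fine (A i j)) (fun i j => fine (B i j)) (sharp_comp A B).
Proof.
move=> A_cols x xR j; split=> [i|]; first exact: sharp_comp_le.
exact: le_sharp_comp.
Qed.

Lemma sharp_comp_eqy x j : (forall i, A i j = -oo%E) -> sharp_comp A B x j 0%R = +oo%E.
Proof.
move=> Aj; rewrite mxE; apply/eqP; rewrite -leye_eq.
by apply: le_bigmin => // i _; rewrite Aj; case: (maxplus_app B x i 0%R).
Qed.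

End SharpComp.

(** * The game of [h_lam], with [2 m] positions *)

Section SpectralGame.
Context {R : realType} {m n : nat} (A B : 'M[\bar R]_(m, n)).
Hypotheses (A_Rmax : Rmax_mx A) (B_Rmax : Rmax_mx B).
Hypothesis A_rows : forall i, exists j, A i j != -oo%E.
Hypothesis B_rows : forall i, exists j, B i j != -oo%E.
Hypothesis AB_cols : forall j, exists i, A i j != -oo%E \/ B i j != -oo%E.

(* The position [(i, true)] comes from [lam + A^# B], [(i, false)] from
   [- lam + B^# A]. *)
Definition paid (p : 'I_m * bool) (j : 'I_n) : \bar R := (if p.2 then A else B) p.1 j.
Definition received (p : 'I_m * bool) (j : 'I_n) : \bar R := (if p.2 then B else A) p.1 j.

Definition spectral_cA p j := paid p j != -oo%E.
Definition spectral_dA p j := received p j != -oo%E.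
Definition spectral_c p j := fine (paid p j).
Definition spectral_d (lam : R) p j :=
  fine (received p j) + (if p.2 then lam else - lam).

Lemma spectral_dA_ex p : exists k, spectral_dA p k.
Proof. by case: p => i []; [exact: B_rows|exact: A_rows]. Qed.

Lemma spectral_cA_ex j : exists p, spectral_cA p j.
Proof. by have [i []] := AB_cols j; [exists (i, true)|exists (i, false)]. Qed.

(** The minimum of two game maps is the game map on the disjoint union of their positions. Where a
    column of [A] or of [B] is [-oo], that half has value [+oo] and Min moves in the other half,
    which [AB_cols] makes possible. *)
Lemma spectral_map_game lam :
  game_map spectral_cA spectral_dA spectral_c (spectral_d lam) (spectral_map A B lam).
Proof.
have shift (u v w : R) (y : \bar R) : ((u + w - v)%:E + y = w%:E + ((u - v)%:E + y))%E.
  by rewrite addeA -EFinD; congr (_%:E + _)%E; ring.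
have shiftN (u v w : R) (y : \bar R) :
    ((u - w - v)%:E + y = - w%:E + ((u - v)%:E + y))%E.
  by rewrite -EFinN -shift.
move=> x xR j.
have -> : spectral_map A B lam x j 0%R =
    mine (lam%:E + sharp_comp A B x j 0%R)%E (- lam%:E + sharp_comp B A x j 0%R)%E.
  by rewrite mxE; congr mine; rewrite mxE.
split=> [[i []]|].
- move=> /(sharp_comp_le A B A_Rmax B_Rmax B_rows x _ _ xR)[k [Bk H]]; exists k; split=> //.
  by rewrite ge_min shift leeD2l.
- move=> /(sharp_comp_le B A B_Rmax A_Rmax A_rows x _ _ xR)[k [Bk H]]; exists k; split=> //.
  by rewrite ge_min orbC shiftN leeD2l.
have sharpN (C D : 'M[\bar R]_(m, n)) : ~ (exists i, C i j != -oo%E) -> 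
    sharp_comp C D x j 0%R = +oo%E.
  move=> CN; apply: sharp_comp_eqy => i.
  by have [//|Ci] := eqVneq (C i j) -oo%E; case: CN; exists i.
have posA : (exists i, A i j != -oo%E) -> exists p, p.2 = true /\ spectral_cA p j /\
    forall k, spectral_dA p k -> ((spectral_d lam p k - spectral_c p j)%:E + x k 0%R
      <= lam%:E + sharp_comp A B x j 0%R)%E.
  move=> /(le_sharp_comp A B A_Rmax B_Rmax x j xR)[i [Ai H]].
  by exists (i, true); do !split=> //; move=> k /H Hk; rewrite shift leeD2l.
have posB : (exists i, B i j != -oo%E) -> exists p, p.2 = false /\ spectral_cA p j /\
    forall k, spectral_dA p k -> ((spectral_d lam p k - spectral_c p j)%:E + x k 0%R
      <= - lam%:E + sharp_comp B A x j 0%R)%E.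
  move=> /(le_sharp_comp B A B_Rmax A_Rmax x j xR)[i [Ai H]].
  by exists (i, false); do !split=> //; move=> k /H Hk; rewrite shiftN leeD2l.
case: (pselect (exists i, A i j != -oo%E)) => [Aj|/[dup] NA /sharpN ->].
  case: (pselect (exists i, B i j != -oo%E)) => [Bj|/sharpN ->].
    rewrite minElt; case: ifP => _.
      by have [p [_ ?]] := posA Aj; exists p.
    by have [p [_ ?]] := posB Bj; exists p.
  by have [p [_ ?]] := posA Aj; exists p; rewrite min_l // leey.
have Bj : exists i, B i j != -oo%E.
  by have [i [Ai|Bi]] := AB_cols j; [case: NA|]; exists i.
by have [p [_ ?]] := posB Bj; exists p; rewrite min_r // leey.
Qed.

Section Line.
Variables (sigma : 'I_n -> 'I_m * bool) (tau : 'I_m * bool -> 'I_n) (l : nat).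
Variable p : ('I_m * bool)%type.

(** This is the [t] of the slope [(l - 2 t) / l]: each step at a position [(i, false)] contributes
    [- lam] instead of [lam]. *)
Definition minus_count : nat := \sum_(s < l) ~~ (iter s (sigma \o tau) p).2.

Lemma cycle_sum_affine lam : cycle_sum spectral_c (spectral_d lam) sigma tau l p =
  cycle_sum spectral_c (spectral_d 0) sigma tau l p + (l%:R - 2 * minus_count%:R) * lam.
Proof.
have -> : (l%:R - 2 * minus_count%:R) * lam =
    \sum_(s < l) (if (iter s (sigma \o tau) p).2 then lam else - lam).
  rewrite /minus_count natr_sum mulrBl mulr_sumr mulr_suml -[in l%:R](card_ord l).
  rewrite -sum1_card natr_sum mulr_suml -sumrB; apply: eq_bigr => s _.
  by case: (iter s _ _).2 => /=; lra.
rewrite /cycle_sum /orbit_sum -big_split; apply: eq_bigr => s _ /=.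
by rewrite /step_weight /spectral_d; case: (iter s _ _).2 => /=; rewrite ?oppr0; lra.
Qed.

(* Regrouped along the cycle, the weight is a sum of differences of entries of
   [A] and [B] on the same row. *)
Lemma cycle_sum_bound (D : R) :
  (forall i j k, A i j != -oo%E -> B i k != -oo%E -> `|fine (A i j) - fine (B i k)| <= D) ->
  (forall j, spectral_cA (sigma j) j) -> (forall q, spectral_dA q (tau q)) ->
  is_cycle sigma tau l p ->
  `|cycle_sum spectral_c (spectral_d 0) sigma tau l p| <= D *+ l.
Proof.
move=> HD sP tP /and3P[_ _ /eqP cyc].
pose F q := spectral_d 0 q (tau q).
have -> : cycle_sum spectral_c (spectral_d 0) sigma tau l p =
    orbit_sum (sigma \o tau)
      (fun q => F (sigma (tau q)) - spectral_c (sigma (tau q)) (tau q)) l p.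
  transitivity (orbit_sum (sigma \o tau) F l p -
      orbit_sum (sigma \o tau) (fun q => spectral_c (sigma (tau q)) (tau q)) l p).
    by rewrite /orbit_sum -sumrB.
  by rewrite -(orbit_sum_cyc F _ _ cyc) /orbit_sum -sumrB.
apply: le_trans (ler_norm_sum _ _ _) _.
rewrite -[in D *+ l](card_ord l) -sumr_const; apply: ler_sum => s _.
set q := iter s _ _; rewrite /F.
have := sP (tau q); have := tP (sigma (tau q)).
rewrite /spectral_dA /spectral_cA /spectral_d /spectral_c /received /paid.
case: (sigma (tau q)) => i [] /= H1 H2.
  by rewrite addr0 distrC HD.
by rewrite oppr0 addr0 HD.
Qed.

End Line.
End SpectralGame.

(** * Bounds on differences of entries in a common row *)

Section Delta.
Context {R : realType} {m n : nat}.
Implicit Types A B : 'M[\bar R]_(m, n).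

Lemma Cupper_ge A B i j k : A i j != -oo%E -> B i k != -oo%E ->
  (A i j - B i k <= Cupper A B)%E.
Proof.
move=> Aij Bik; apply: (bigmax_sup i) => //.
apply: (bigmax_sup j) => //.
exact: (bigmax_sup k).
Qed.

Lemma Clower_le A B i j k : A i j != -oo%E -> B i k != -oo%E ->
  (Clower A B <= A i j - B i k)%E.
Proof.
move=> Aij Bik; apply: (bigmin_inf i) => //.
apply: (bigmin_inf j) => //.
exact: (bigmin_inf k).
Qed.

Lemma Cupper_lty A B : Rmax_mx A -> Rmax_mx B -> (Cupper A B < +oo)%E.
Proof.
move=> AR BR; apply: bigmax_lt => [|i _]; first by rewrite ltNye.
apply: bigmax_lt => [|j Aij]; first by rewrite ltNye.
apply: bigmax_lt => [|k]; first by rewrite ltNye.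
by have := AR i j; have := BR i k; case: (A i j) => [?||] //; case: (B i k) => [?||] //;
  rewrite ?ltry.
Qed.

(** Each difference and its opposite both occur in [Delta], which therefore bounds absolute values.
    A row with finite entries in both matrices exists, so [Delta] is nonnegative. *)
Lemma Delta_bound A B : (0 < m)%N -> Rmax_mx A -> Rmax_mx B ->
  (forall i, exists j, A i j != -oo%E) -> (forall i, exists j, B i j != -oo%E) ->
  exists D : R, [/\ Delta A B = D%:E, 0 <= D & forall i j k, A i j != -oo%E -> B i k != -oo%E ->
    `|fine (A i j) - fine (B i k)| <= D].
Proof.
move=> m0 AR BR Ar Br.
have bound i j k : A i j != -oo%E -> B i k != -oo%E ->
    (`|fine (A i j) - fine (B i k)|%:E <= Delta A B)%E.
  move=> Aij Bik; have := Cupper_ge A B i j k Aij Bik; have := Cupper_ge B A i k j Bik Aij.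
  move: Aij Bik; have := AR i j; have := BR i k.
  case: (A i j) => [a||] //; case: (B i k) => [b||] // _ _ _ _ /= H1 H2.
  rewrite /Delta le_max; have [ab|/ltW ab] := lerP 0 (a - b).
    rewrite (ger0_norm ab).
    by apply/orP; left; exact: H2.
  by rewrite (ler0_norm ab) opprB; apply/orP; right; exact: H1.
have [j Aj] := Ar (Ordinal m0); have [k Bk] := Br (Ordinal m0).
have dpos : (0 <= Delta A B)%E by apply: le_trans (bound _ _ _ Aj Bk); rewrite lee_fin.
have dfin : Delta A B \is a fin_num.
  by rewrite ge0_fin_numE // gt_max !Cupper_lty.
exists (fine (Delta A B)); split=> [||i j' k' Aj' Bk']; rewrite ?fineK ?fine_ge0 //.
by rewrite -lee_fin fineK // bound.
Qed.
End Delta.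

(** * Order of lines to the left of their crossings *)

Section Lines.
Context {R : realType}.
Variables a1 a2 th1 th2 D K lam0 : R.
Hypotheses (a1D : `|a1| <= D) (a2D : `|a2| <= D).
Hypothesis gap : th1 != th2 -> 1 <= K * `|th1 - th2|.
Hypothesis lam0_lt : lam0 < - (K * D).
Hypothesis le0 : a1 + (1 - 2 * th1) * lam0 <= a2 + (1 - 2 * th2) * lam0.

(** The lines cross where [2 (th1 - th2) lam = a1 - a2], hence at some [|lam| <= K D]. Strictly to
    the left of that, the lower line is the one of larger slope. *)
Lemma line_slope_le : th1 <= th2.
Proof.
rewrite leNgt; apply/negP => th21.
have D0 : 0 <= D := le_trans (normr_ge0 _) a1D.
have := gap (negbT (gt_eqF th21)); rewrite ger0_norm; last by rewrite subr_ge0 ltW.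
move=> g.
move: a1D a2D; rewrite !ler_norml => /andP[? ?] /andP[? ?].
have : D <= (K * (th1 - th2)) * D by rewrite ler_peMl.
have : (th1 - th2) * lam0 < (th1 - th2) * - (K * D) by rewrite ltr_pM2l // subr_gt0.
have -> : (th1 - th2) * - (K * D) = - (K * (th1 - th2) * D) by ring.
move: (_ * D) => w.
have : a1 - a2 <= 2 * ((th1 - th2) * lam0) by move: le0; lra.
move: (_ * lam0) => u; lra.
Qed.

Lemma line_le lam : lam <= - (K * D) ->
  a1 + (1 - 2 * th1) * lam <= a2 + (1 - 2 * th2) * lam.
Proof.
move=> lamK; have [e|ne] := eqVneq th1 th2; first by move: le0; rewrite e; lra.
have D0 : 0 <= D := le_trans (normr_ge0 _) a1D.
move: (gap ne); rewrite ler0_norm ?subr_le0 ?line_slope_le // opprB => g.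
move: a1D a2D; rewrite !ler_norml => /andP[? ?] /andP[? ?].
have : D <= (K * (th2 - th1)) * D by rewrite ler_peMl.
have : (th2 - th1) * lam <= (th2 - th1) * - (K * D).
  by rewrite ler_wpM2l // subr_ge0 line_slope_le.
lra.
Qed.
End Lines.

(** The difference is a nonzero integer divided by [l1 l2], and [l1 l2 <= N ^ 2]. *)
Lemma fraction_gap (R : realType) (t1 l1 t2 l2 N : nat) :
  (0 < l1)%N -> (0 < l2)%N -> (l1 <= N)%N -> (l2 <= N)%N ->
  t1%:R / l1%:R != t2%:R / l2%:R :> R ->
  1 <= (N ^ 2)%:R * `|t1%:R / l1%:R - t2%:R / l2%:R| :> R.
Proof.
move=> l10 l20 l1N l2N ne.
have l1R : 0 < l1%:R :> R by rewrite ltr0n.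
have l2R : 0 < l2%:R :> R by rewrite ltr0n.
have e : t1%:R / l1%:R - t2%:R / l2%:R =
    ((t1 * l2)%N%:Z - (t2 * l1)%N%:Z)%:~R / (l1%:R * l2%:R) :> R.
  by rewrite intrB -!pmulrn !natrM; field; rewrite !gt_eqF.
move: ne; rewrite -subr_eq0 e.
set z : int := _ - _ => ne.
rewrite normrM normfV -intr_norm (ger0_norm (mulr_ge0 (ltW l1R) (ltW l2R))).
rewrite mulrA ler_pdivlMr ?mulr_gt0 // mul1r -natrM.
have z1 : 1 <= `|z| by move: ne; case: (z =P 0) => [->|]; [rewrite mul0r eqxx|lia].
apply: (@le_trans _ _ ((N ^ 2)%:R * 1)).
  by rewrite mulr1 ler_nat; nia.
by rewrite ler_wpM2l ?ler0n // ler1z.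
Qed.

(** Against the fraction 0 the gap is [1 / N]; this is the source of [kappa] in place of [kappa ^ 2]
    when no column is [-oo]. *)
Lemma fraction_gap0 (R : realType) (t l N : nat) : (0 < l)%N -> (l <= N)%N ->
  t%:R / l%:R != 0 :> R -> 1 <= N%:R * (t%:R / l%:R) :> R.
Proof.
move=> l0 lN; rewrite mulrA ler_pdivlMr ?ltr0n // mul1r -natrM ler_nat.
by case: t => [|t _]; [rewrite mul0r eqxx|nia].
Qed.

(** * The spectral function far to the left *)

Section LeftHalf.
Context {R : realType} {m n : nat} (A B : 'M[\bar R]_(m, n)).
Hypothesis n_gt0 : (0 < n)%N.
Hypotheses (A_Rmax : Rmax_mx A) (B_Rmax : Rmax_mx B).
Hypothesis A_rows : forall i, exists j, A i j != -oo%E.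
Hypothesis B_rows : forall i, exists j, B i j != -oo%E.
Hypothesis AB_cols : forall j, exists i, A i j != -oo%E \/ B i j != -oo%E.

Definition spectral_line sigma tau l p (lam : R) : R :=
  cycle_sum (spectral_c A B) (spectral_d A B 0) sigma tau l p / l%:R
  + (1 - 2 * ((minus_count sigma tau l p)%:R / l%:R)) * lam.

Lemma spectral_lineE sigma tau l p lam : (0 < l)%N ->
  cycle_mean (spectral_c A B) (spectral_d A B lam) sigma tau l p =
  spectral_line sigma tau l p lam.
Proof.
move=> l0; rewrite /cycle_mean cycle_sum_affine /spectral_line; field.
by rewrite pnatr_eq0 -lt0n.
Qed.

Definition admissible (sigma : 'I_n -> 'I_m * bool) (tau : 'I_m * bool -> 'I_n) l p : Prop :=
  [/\ forall j, spectral_cA A B (sigma j) j, forall q, spectral_dA A B q (tau q) &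
      is_cycle sigma tau l p].

(** The line optimal at [lam0] stays optimal at every [lam] where its order relative to each
    admissible line is unchanged, since the bounds on the value only compare with this line. The
    second clause records its optimality at [lam0] against each strategy of Min. *)
Lemma spectral_function_germ lam0 : exists sigma tau l p, [/\ admissible sigma tau l p,
  forall sigma', (forall j, spectral_cA A B (sigma' j) j) -> exists tau' l' p',
    admissible sigma' tau' l' p' /\
    spectral_line sigma tau l p lam0 <= spectral_line sigma' tau' l' p' lam0 &
  forall lam, (forall sigma' tau' l' p', admissible sigma' tau' l' p' ->
     (spectral_line sigma tau l p lam0 <= spectral_line sigma' tau' l' p' lam0 ->
      spectral_line sigma tau l p lam <= spectral_line sigma' tau' l' p' lam) /\
     (spectral_line sigma' tau' l' p' lam0 <= spectral_line sigma tau l p lam0 ->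
      spectral_line sigma' tau' l' p' lam <= spectral_line sigma tau l p lam)) ->
   eigenvalues (spectral_map A B lam) (spectral_line sigma tau l p lam)%:E /\
   spectral_function A B lam = (spectral_line sigma tau l p lam)%:E].
Proof.
have dA_ex := spectral_dA_ex A B A_rows B_rows.
have [sigma [tau [l [p [[sP tP] cyc vge vle]]]]] :=
  value_exists _ _ (spectral_c A B) (spectral_d A B lam0) n_gt0 dA_ex
    (spectral_cA_ex A B AB_cols).
have [l0 _ _] := and3P cyc.
rewrite spectral_lineE // in vge vle.
have ge0 sigma' : (forall j, spectral_cA A B (sigma' j) j) -> exists tau' l' p',
    admissible sigma' tau' l' p' /\
    spectral_line sigma tau l p lam0 <= spectral_line sigma' tau' l' p' lam0.
  move=> s'P; have [tau' [t'P [l' [p' [cyc' le']]]]] := vge sigma' s'P.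
  exists tau', l', p'; split; first by split.
  by rewrite -(spectral_lineE sigma') ?cycle_mean_ge //; case/and3P: cyc'.
exists sigma, tau, l, p; split=> // lam cmp.
have [||eig ub] := game_spectral_radius (v := spectral_line sigma tau l p lam) n_gt0 dA_ex
  (spectral_map_game A B A_Rmax B_Rmax A_rows B_rows AB_cols lam).
- move=> sigma' s'P; have [tau' [l' [p' [adm le']]]] := ge0 sigma' s'P.
  have [_ t'P cyc'] := adm; exists tau'; split=> //; exists l', p'; split=> //.
  rewrite -cycle_mean_ge // spectral_lineE; last by case/and3P: cyc'.
  exact: (cmp _ _ _ _ adm).1.
- have [sigma' [s'P H]] := vle; exists sigma'; split=> // tau' t'P l' p' cyc'.
  have [l'0 _ _] := and3P cyc'.
  rewrite -cycle_mean_le // spectral_lineE //; apply: (cmp _ _ _ _ _).2; first by split.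
  by rewrite -spectral_lineE // cycle_mean_le // H.
by split=> //; exact: spectral_radiusE.
Qed.

(* Two moves on the same row [i] with opposite signs cost nothing in total:
   take [j] maximizing [a_ij + x_j]. *)
Lemma spectral_eigenvalue_le0 lam w : eigenvalues (spectral_map A B lam) w%:E -> w <= 0.
Proof.
move=> [_ [x [xR [j0 xj0] xE]]].
have fP := spectral_map_game A B A_Rmax B_Rmax A_rows B_rows AB_cols lam _ xR.
have [[i b] pj0] := spectral_cA_ex A B AB_cols j0.
have step j p : spectral_cA A B p j -> exists k, spectral_dA A B p k /\
    (w%:E + x j 0%R <= (spectral_d A B lam p k - spectral_c A B p j)%:E + x k 0%R)%E.
  move=> pj; have [k [dk H]] := (fP j).1 p pj; exists k; split=> //.
  by move: H; rewrite -xE mxE.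
have paidN k : paid A B (i, ~~ b) k = received A B (i, b) k.
  by rewrite /paid /received /=; case: (b).
have receivedN k : received A B (i, ~~ b) k = paid A B (i, b) k.
  by rewrite /paid /received /=; case: (b).
have [j _ jmax] := @arg_maxP _ _ _ j0 xpredT (fun k => paid A B (i, b) k + x k 0%R)%E isT.
have paidR k : paid A B (i, b) k != +oo%E by rewrite /paid; case: (b).
have jfin : (paid A B (i, b) j + x j 0%R != -oo)%E.
  have : (paid A B (i, b) j0 + x j0 0%R != -oo)%E by rewrite adde_eq_ninfty negb_or; apply/andP.
  by apply: contra_neq => e; apply/eqP; rewrite -leeNy_eq -e; exact: jmax.
move: jfin; rewrite adde_eq_ninfty negb_or => /andP[pj xj].
(* From [j] via [(i, b)] to [k], then via [(i, ~~ b)] to [k']. In the sum of both inequalities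
   [lam], [x k] and the entry at [k] cancel, and [2 w] is at most the difference of the maximised
   quantity at [k'] and at [j]. *)
have [k [dk Hk]] := step j _ pj.
have [|k' [dk' Hk']] := step k (i, ~~ b); first by rewrite /spectral_cA paidN.
have := jmax k' isT; move: Hk Hk' dk dk' (paidR j) (paidR k') pj xj (xR j 0) (xR k 0) (xR k' 0).
rewrite /spectral_dA /spectral_d /spectral_c !paidN !receivedN /=.
case: (x j 0%R) => [xj||] //; case: (x k 0%R) => [xk||] //; case: (x k' 0%R) => [xk'||] //.
case: (paid A B (i, b) j) => [pj||] //; case: (paid A B (i, b) k') => [pk'||] //=.
by rewrite -!EFinD !lee_fin; case: (b) => /=; lra.
Qed.

Lemma shift_appE (a : \bar R) (x : 'cV[\bar R]_n) j :
  shift_app a x j 0 = (a + x j 0%R)%E.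
Proof. by rewrite mxE. Qed.

Section Left.
Variables (D : R) (kappa : nat).
Hypothesis kappaE : kappa = minn (2 * m) n.
Hypothesis D_ge0 : 0 <= D.
Hypothesis D_bound : forall i j k, A i j != -oo%E -> B i k != -oo%E ->
  `|fine (A i j) - fine (B i k)| <= D.

Lemma admissible_line sigma tau l p : admissible sigma tau l p ->
  [/\ (0 < l)%N, (l <= kappa)%N &
    `|cycle_sum (spectral_c A B) (spectral_d A B 0) sigma tau l p / l%:R| <= D].
Proof.
move=> [sP tP cyc]; have [l0 lK _] := and3P cyc; split=> //.
  by move: lK; rewrite card_prod card_ord card_bool mulnC kappaE.
rewrite normrM normfV normr_nat ler_pdivrMr ?ltr0n // mulr_natr.
exact: cycle_sum_bound.
Qed.

Lemma spectral_function_left : exists (l t : nat) (alpha : R),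
  [/\ (1 <= l <= kappa)%N, (t <= l./2)%N & forall lam, lam <= - ((kappa ^ 2)%:R * D) ->
    spectral_function A B lam = (lam * (l%:Z - 2 * t%:Z)%:~R / l%:R + alpha)%:E].
Proof.
pose K : R := (kappa ^ 2)%:R.
(* The point lies strictly to the left of every crossing, so the order of lines there decides the
   order of slopes. *)
pose lam0 := - (K * D) - 1.
have lam0_lt : lam0 < - (K * D) by rewrite /lam0; lra.
have [sigma [tau [l [p [adm _ germ]]]]] := spectral_function_germ lam0.
have [l0 lK aD] := admissible_line _ _ _ _ adm.
have {}germ lam : lam <= - (K * D) ->
    eigenvalues (spectral_map A B lam) (spectral_line sigma tau l p lam)%:E /\
    spectral_function A B lam = (spectral_line sigma tau l p lam)%:E.
  move=> lamK; apply: germ => sigma' tau' l' p' /admissible_line[l'0 l'K a'D].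
  split=> le.
    exact: (line_le _ _ _ _ _ _ _ aD a'D (fraction_gap _ _ _ _ _ _ l0 l'0 lK l'K) lam0_lt le).
  exact: (line_le _ _ _ _ _ _ _ a'D aD (fraction_gap _ _ _ _ _ _ l'0 l0 l'K lK) lam0_lt le).
set t := minus_count sigma tau l p.
set a := cycle_sum _ _ _ _ _ _ / _ in aD.
have lineE lam : spectral_line sigma tau l p lam =
    lam * (l%:Z - 2 * t%:Z)%:~R / l%:R + a.
  rewrite /spectral_line -/t -/a intrB intrM -!pmulrn addrC; congr (_ + _).
  by field; rewrite pnatr_eq0 -lt0n.
exists l, t, a; split.
- by rewrite l0.
- (* a negative slope would make [s] positive far to the left *)
  rewrite geq_half_double leqNgt; apply/negP => tl.
  (* The slope is at most [- 1 / l], so moving [(|a| + 1) l] beyond the threshold raises the line by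
     at least [|a| + 1]. *)
  pose lam := - (K * D) - (`|a| + 1) * l%:R.
  have a1 : 0 <= (`|a| + 1) * l%:R by rewrite mulr_ge0 // addr_ge0.
  have KD : 0 <= K * D by rewrite mulr_ge0.
  have lamK : lam <= - (K * D) by rewrite /lam; lra.
  have [/spectral_eigenvalue_le0 + _] := germ _ lamK; rewrite lineE leNgt => /negP; apply.
  have l0R : 0 < l%:R :> R by rewrite ltr0n.
  have slope : 1 <= (2 * t%:R - l%:R) :> R.
    by rewrite lerBrDr nat1r -natrM ler_nat; lia.
  have e : lam * (l%:Z - 2 * t%:Z)%:~R / l%:R =
      K * D * (2 * t%:R - l%:R) / l%:R + (`|a| + 1) * (2 * t%:R - l%:R).
    rewrite intrB intrM -!pmulrn /lam; field.
    by rewrite gt_eqF.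
  have H1 : 0 <= K * D * (2 * t%:R - l%:R) / l%:R.
    by rewrite divr_ge0 // mulr_ge0 //; lra.
  have H2 : `|a| + 1 <= (`|a| + 1) * (2 * t%:R - l%:R) by rewrite ler_peMr // addr_ge0.
  by have := lerNnormlW (lexx `|a|); rewrite e; lra.
- by move=> lam lamK; rewrite -lineE; have [] := germ _ lamK.
Qed.

(** The last clause also covers sub-eigenvectors: an eigenvector of [h_lam] is only one of those for
    [A^# B]. *)
Lemma sharp_comp_radius : (forall j, exists i, A i j != -oo%E) -> exists v : R,
  eigenvalues (sharp_comp A B) v%:E /\
  (forall w, eigenvalues (sharp_comp A B) w -> (w <= v%:E)%E) /\
  forall mu (x : 'cV[\bar R]_n), Rmax_mx x -> (exists j, x j 0 != -oo%E) ->
    (forall j, (mu%:E + x j 0%R <= sharp_comp A B x j 0%R)%E) -> mu <= v.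
Proof.
move=> A_cols; have fP := sharp_comp_game A B A_Rmax B_Rmax B_rows A_cols.
have [sigma [tau [l [p [_ cyc vge vle]]]]] := value_exists _ _
  (fun i j => fine (A i j)) (fun i j => fine (B i j)) n_gt0 B_rows A_cols.
have [eig ub] := game_spectral_radius n_gt0 B_rows fP vge vle.
exists (cycle_mean (fun i j => fine (A i j)) (fun i j => fine (B i j)) sigma tau l p).
split=> //; split=> // mu x xR xN le.
exact: (sub_eigenvalue_le _ _ _ _ B_rows _ fP _ _ _ vle xR xN le).
Qed.

Lemma spectral_map_le lam x j :
  (spectral_map A B lam x j 0%R <= lam%:E + sharp_comp A B x j 0%R)%E.
Proof. by rewrite mxE ge_min mxE lexx. Qed.

(** The optimal line has slope 1, so only gaps between 0 and another fraction matter. The bound on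
    [alpha] comes from an eigenvector of [h_lam0], as [h_lam0 <= lam0 + A^# B]. *)
Lemma spectral_function_left_cols : (forall j, exists i, A i j != -oo%E) ->
  exists alpha : R, (alpha%:E <= spectral_radius (sharp_comp A B))%E /\
  forall lam, lam <= - (kappa%:R * D) -> spectral_function A B lam = (lam + alpha)%:E.
Proof.
move=> A_cols; pose K : R := kappa%:R.
pose lam0 := - (K * D) - 1.
have lam0_lt : lam0 < - (K * D) by rewrite /lam0; lra.
have [sigma [tau [l [p [adm vge germ]]]]] := spectral_function_germ lam0.
have [l0 lK aD] := admissible_line _ _ _ _ adm.
(* Against the strategy of Min that only plays rows of [A], all slopes are 1. *)
have slope1 : (minus_count sigma tau l p)%:R / l%:R = 0 :> R.
  have [|tau' [l' [p' [adm' le']]]] := vge (fun j => (xchoose (A_cols j), true)).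
    by move=> j; exact: (xchooseP (A_cols j)).
  have [l'0 l'K a'D] := admissible_line _ _ _ _ adm'.
  have t0 : minus_count (fun j => (xchoose (A_cols j), true)) tau' l' p' = 0%N.
    have [_ _ /and3P[_ _ /eqP cyc]] := adm'.
    (* The starting position also belongs to [A]: the cycle returns to it by a move of Min. *)
    have p'2 : p'.2 by rewrite -cyc; case: (l') l'0.
    by apply: big1 => [[[|s] sl] _] //=; rewrite p'2.
  apply/eqP; rewrite eq_le divr_ge0 ?ler0n // andbT.
  apply: (line_slope_le _ _ _ _ _ _ _ aD a'D _ lam0_lt).
    by rewrite subr0 ger0_norm ?divr_ge0 //; exact: fraction_gap0.
  by move: le'; rewrite {2}/spectral_line t0 mul0r.
set a := cycle_sum _ _ _ _ _ _ / _ in aD.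
have lineE lam : spectral_line sigma tau l p lam = lam + a.
  by rewrite /spectral_line slope1 -/a; ring.
have {}germ lam : lam <= - (K * D) ->
    eigenvalues (spectral_map A B lam) (spectral_line sigma tau l p lam)%:E /\
    spectral_function A B lam = (spectral_line sigma tau l p lam)%:E.
  move=> lamK; apply: germ => sigma' tau' l' p' /admissible_line[l'0 l'K a'D].
  set th := (minus_count sigma' tau' l' p')%:R / l'%:R : R.
  have gapr : th != 0 -> 1 <= K * `|th - 0|.
    by rewrite subr0 ger0_norm ?divr_ge0 //; exact: fraction_gap0.
  have gapl : 0 != th -> 1 <= K * `|0 - th| by rewrite eq_sym distrC.
  rewrite /spectral_line slope1; split=> le.
    exact: (line_le _ _ _ _ _ _ _ aD a'D gapl lam0_lt le).
  exact: (line_le _ _ _ _ _ _ _ a'D aD gapr lam0_lt le).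
exists a; split; last by move=> lam /germ[_ ->]; rewrite lineE.
have [v [eig [ub sub]]] := sharp_comp_radius A_cols.
rewrite (spectral_radiusE _ _ _ _ eig ub) lee_fin.
have [[_ [x [xR xN xE]]] _] := germ lam0 (ltW lam0_lt).
apply: (sub a x xR xN) => j; have := spectral_map_le lam0 x j.
by rewrite -xE lineE mxE EFinD -addeA leeD2lE.
Qed.

End Left.

(** For such [lam] the minimum in [h_lam] is always its first term, so [h_lam] is [A^# B] shifted by
    [lam]. *)
Lemma spectral_function_real lam : (0 < m)%N -> (forall i j, A i j \is a fin_num) ->
  (forall i j, B i j \is a fin_num) ->
  (forall i j k, lam <= fine (A i j) - fine (B i k)) ->
  spectral_function A B lam = (lam%:E + spectral_radius (sharp_comp A B))%E.
Proof.
move=> m_gt0 A_fin B_fin lam_le.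
have A_oo i j : A i j != -oo%E by have := A_fin i j; rewrite fin_numE => /andP[].
have B_oo i j : B i j != -oo%E by have := B_fin i j; rewrite fin_numE => /andP[].
have hE x : Rmax_mx x -> spectral_map A B lam x = shift_app lam%:E (sharp_comp A B x).
  move=> xR; apply/colP => j; rewrite mxE min_l //.
  have [i [_ B_le]] := le_sharp_comp B A B_Rmax A_Rmax x j xR
    (ex_intro _ (Ordinal m_gt0) (B_oo _ j)).
  have [k [_ A_le]] := sharp_comp_le A B A_Rmax B_Rmax B_rows x j i xR (A_oo i j).
  (* Here [i] attains the minimum in [B^# A x] at [j] and [k] is a reply of Max for [A^# B] in row
     [i]; the coordinate [x k] separates the two terms of [h_lam]. *)
  apply: (@le_trans _ _ (x k 0%R)); rewrite mxE.
    apply: (@le_trans _ _ (lam%:E + ((fine (B i k) - fine (A i j))%:E + x k 0%R))%E).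
      by rewrite leeD2l.
    rewrite addeA -EFinD geeDr // lee_fin.
    by have := lam_le i j k; lra.
  apply: (@le_trans _ _ (- lam%:E + ((fine (A i k) - fine (B i j))%:E + x k 0%R))%E).
    rewrite addeA -EFinN -EFinD leeDr // lee_fin.
    by have := lam_le i k j; lra.
  by rewrite leeD2l // B_le // A_oo.
have [v [[_ [x [xR xN xE]]] [ub _]]] := sharp_comp_radius
  (fun j => ex_intro _ (Ordinal m_gt0) (A_oo _ j)).
have eig : eigenvalues (sharp_comp A B) v%:E by split=> //; exists x.
rewrite (spectral_radiusE _ _ _ _ eig ub); apply: spectral_radiusE.
  split=> //; exists x; split=> //; rewrite hE // -xE.
  by apply/colP => j; rewrite !mxE addeA.
move=> [w||] [// _ [y [yR yN yE]]]; last by rewrite leNye.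
have : ((w - lam)%:E <= v%:E)%E.
  apply: ub; split=> //; exists y; split=> //; apply/colP => j.
  move/colP/(_ j): yE; rewrite hE // !shift_appE => yE.
  by rewrite EFinB addeAC yE addeAC subee // add0e.
by rewrite -EFinD !lee_fin lerBlDl.
Qed.

End LeftHalf.

(** * Exchange of [A] and [B], and assembly of both half-lines *)

Lemma spectral_functionC (R : realType) (m n : nat) (A B : 'M[\bar R]_(m, n)) lam :
  spectral_function A B lam = spectral_function B A (- lam).
Proof.
congr spectral_radius; apply/funext => x; apply/colP => j.
by rewrite [LHS]mxE [RHS]mxE minC EFinN oppeK.
Qed.

Theorem theorem6 (R : realType) (m n : nat) (m_gt0 : (0 < m)%N) (n_gt0 : (0 < n)%N)
    (A B : 'M[\bar R]_(m, n)) (kappa : nat)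
    (A_Rmax : Rmax_mx A) (B_Rmax : Rmax_mx B)
    (A_rows : forall i, exists j, A i j != -oo%E)
    (B_rows : forall i, exists j, B i j != -oo%E)
    (AB_cols : forall j, exists i, A i j != -oo%E \/ B i j != -oo%E)
    (kappaE : kappa = minn (2 * m) n) :
  [/\ (exists (l1 l2 t1 t2 : nat) (k1 k2 : int) (alpha1 alpha2 : R),
        [/\ (1 <= l1 <= kappa)%N,
            (t1 <= l1./2)%N /\ k1 = l1%:Z - 2 * t1%:Z,
            (1 <= l2 <= kappa)%N,
            (t2 <= l2./2)%N /\ k2 = l2%:Z - 2 * t2%:Z &
            (forall lam : R,
               (lam%:E <= - ((2 * kappa ^ 2)%N%:R%:E * Delta A B))%E ->
               spectral_function A B lam = (lam * k1%:~R / l1%:R + alpha1)%:E) /\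
            (forall lam : R,
               ((2 * kappa ^ 2)%N%:R%:E * Delta A B <= lam%:E)%E ->
               spectral_function A B lam = (- lam * k2%:~R / l2%:R + alpha2)%:E)]),
      (forall j, exists i, A i j != -oo%E) ->
      (forall j, exists i, B i j != -oo%E) ->
      (exists alpha1 alpha2 : R,
        [/\ (alpha1%:E <= spectral_radius (sharp_comp A B))%E,
            (alpha2%:E <= spectral_radius (sharp_comp B A))%E,
            (forall lam : R,
               (lam%:E <= - ((2 * kappa)%N%:R%:E * Delta A B))%E ->
               spectral_function A B lam = (lam + alpha1)%:E) &
            (forall lam : R,
               ((2 * kappa)%N%:R%:E * Delta A B <= lam%:E)%E ->
               spectral_function A B lam = (- lam + alpha2)%:E)]) &
      (forall i j, A i j \is a fin_num) ->
      (forall i j, B i j \is a fin_num) ->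
      (forall lam : R, (lam%:E <= Clower A B)%E ->
         spectral_function A B lam
           = (lam%:E + spectral_radius (sharp_comp A B))%E) /\
      (forall lam : R, (Cupper A B <= lam%:E)%E ->
         spectral_function A B lam
           = (- lam%:E + spectral_radius (sharp_comp B A))%E)].
Proof.
have BA_cols j : exists i, B i j != -oo%E \/ A i j != -oo%E.
  by have [i [Ai|Bi]] := AB_cols j; exists i; [right|left].
have [D [DE D0 AB_D]] := Delta_bound A B m_gt0 A_Rmax B_Rmax A_rows B_rows.
have BA_D i j k : B i j != -oo%E -> A i k != -oo%E -> `|fine (B i j) - fine (A i k)| <= D.
  by move=> Bij Aik; rewrite distrC AB_D.
(* As [D >= 0], the threshold [- 2 N D] lies to the left of [- N D], where the formulas on the left
   already hold. *)
have le_left (N : nat) lam : (lam%:E <= - ((2 * N)%N%:R%:E * Delta A B))%E ->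
    lam <= - (N%:R * D).
  rewrite DE -EFinM -EFinN lee_fin natrM => /le_trans; apply.
  by rewrite lerN2 ler_wpM2r // ler_peMl ?ler0n // ler1n.
have le_right (N : nat) lam : ((2 * N)%N%:R%:E * Delta A B <= lam%:E)%E ->
    - lam <= - (N%:R * D).
  by move=> le; apply: le_left; rewrite EFinN leeN2.
split.
- have [l1 [t1 [alpha1 [l1K t1l left]]]] := spectral_function_left A B n_gt0
    A_Rmax B_Rmax A_rows B_rows AB_cols D kappa kappaE D0 AB_D.
  have [l2 [t2 [alpha2 [l2K t2l right]]]] := spectral_function_left B A n_gt0
    B_Rmax A_Rmax B_rows A_rows BA_cols D kappa kappaE D0 BA_D.
  exists l1, l2, t1, t2, (l1%:Z - 2 * t1%:Z), (l2%:Z - 2 * t2%:Z), alpha1, alpha2.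
  do !split=> //; move=> lam; first by move=> /le_left/left.
  by move=> /le_right/right; rewrite -spectral_functionC.
- move=> A_cols B_cols.
  have [alpha1 [alpha1_le left]] := spectral_function_left_cols A B n_gt0
    A_Rmax B_Rmax A_rows B_rows AB_cols D kappa kappaE AB_D A_cols.
  have [alpha2 [alpha2_le right]] := spectral_function_left_cols B A n_gt0
    B_Rmax A_Rmax B_rows A_rows BA_cols D kappa kappaE BA_D B_cols.
  exists alpha1, alpha2; split=> // lam; first by move=> /le_left/left.
  by move=> /le_right/right; rewrite -spectral_functionC.
- move=> A_fin B_fin.
  have A_oo i j : A i j != -oo%E by have := A_fin i j; rewrite fin_numE => /andP[].
  have B_oo i j : B i j != -oo%E by have := B_fin i j; rewrite fin_numE => /andP[].
  split=> lam lamC.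
    apply: spectral_function_real => // i j k.
    rewrite -lee_fin EFinB !fineK //; apply: le_trans lamC _; exact: Clower_le.
  rewrite spectral_functionC -EFinN; apply: spectral_function_real => // i j k.
  rewrite -opprB lerN2 -lee_fin EFinB !fineK //; apply: le_trans lamC; exact: Cupper_ge.
Qed.
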